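(* Let $d\ge1$, $L>0$, and let $M\ge2$, $n\ge1$ be integers. Let $H$ be a (nonempty) convex compact subset of $\mathbb{R}^M$, let $p_1,\dots,p_M\in L_2(\mathbb{R}^d)$ be fixed functions and let $X_1,\dots,X_n$ be i.i.d. random vectors in $\mathbb{R}^d$ with density $p\in\mathcal{P}_0$. Define $$\hat\lambda^{\mathbf C}\in\operatorname*{argmin}_{\lambda\in H}\Big\{\|\mathsf{p}_\lambda\|^2-\frac2n\sum_{i=1}^n\mathsf{p}_\lambda(X_i)\Big\},\qquad \tilde p_n^{\mathbf C}=\mathsf{p}_{\hat\lambda^{\mathbf C}}=\sum_{j=1}^M\hat\lambda_j^{\mathbf C}p_j .$$ Then $$R_n(\tilde p_n^{\mathbf C},p)\le\min_{\lambda\in H}\|\mathsf{p}_\lambda-p\|^2+\frac{4LM}{n}.$$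
   Context: $\|g\|=(\int_{\mathbb{R}^d}g^2(x)\,dx)^{1/2}$ is the $L_2(\mathbb{R}^d)$ norm and $\|\cdot\|_\infty$ the $L_\infty(\mathbb{R}^d)$ norm. $\mathcal{P}_0$ is the class of all probability densities $p$ on $\mathbb{R}^d$ (i.e. $p\ge0$, $\int p=1$) with $\|p\|_\infty\le L$. For $\lambda\in\mathbb{R}^M$, $\mathsf{p}_\lambda=\sum_{j=1}^M\lambda_jp_j$. For an estimator $\hat p$ based on the i.i.d. sample $X_1,\dots,X_n$ with density $p$, $R_n(\hat p,p)=E_p^n\|\hat p-p\|^2$, where $E_p^n$ is the expectation with respect to the distribution of $(X_1,\dots,X_n)$. The $p_j$ need not be probability densities. $\hat\lambda^{\mathbf C}$ is a (measurable in the sample) choice of minimizer. *)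

(* Defs.v *)
From HB Require Import structures.
From mathcomp Require Import all_boot all_order all_algebra.
From mathcomp Require Import all_classical all_reals all_analysis.

Set Implicit Arguments.
Unset Strict Implicit.
Unset Printing Implicit Defensive.

Import Order.TTheory GRing.Theory Num.Theory.
Import numFieldNormedType.Exports.

Local Open Scope classical_set_scope.
Local Open Scope ring_scope.

(* Lebesgue measure on [d.-tuple R] (the model of R^d, with its Borel
   sigma-algebra), by recursion on d: the image of [lebesgue_measure \x mu_d]
   under the bijection [(a, t) |-> a :: t]. [lebesgue_Rd_box] below checks the
   characteristic value on measurable boxes. *)
Section lebesgue_cons.
Context (R : realType) (n : nat).
Variable mu : {sigma_finite_measure set (n.-tuple R) -> \bar R}.

Definition cons_prod (x : R * n.-tuple R) : n.+1.-tuple R :=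
  [the n.+1.-tuple R of x.1 :: x.2].

Lemma measurable_cons_prod : measurable_fun setT cons_prod.
Proof. exact: measurable_cons. Qed.

Definition lebesgue_cons : set (n.+1.-tuple R) -> \bar R :=
  pushforward (@lebesgue_measure R \x mu)%E cons_prod.

Let lebesgue_cons0 : lebesgue_cons set0 = 0%E.
Proof. by rewrite /lebesgue_cons /pushforward preimage_set0 measure0. Qed.

Let lebesgue_cons_ge0 A : (0 <= lebesgue_cons A)%E.
Proof. by rewrite /lebesgue_cons /pushforward measure_ge0. Qed.

Let lebesgue_cons_sigma_additive : semi_sigma_additive lebesgue_cons.
Proof.
move=> F mF tF mUF; rewrite /lebesgue_cons /pushforward preimage_bigcup.
apply: measure_semi_sigma_additive.
- by move=> k; rewrite -[X in measurable X]setTI; exact: measurable_cons_prod.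
- apply/trivIsetP => /= i j _ _ ij; rewrite -preimage_setI.
  by move/trivIsetP : tF => /(_ _ _ _ _ ij) ->//; rewrite preimage_set0.
- rewrite -preimage_bigcup -[X in measurable X]setTI.
  exact: measurable_cons_prod.
Qed.

HB.instance Definition _ := isMeasure.Build _ _ _
  lebesgue_cons lebesgue_cons0 lebesgue_cons_ge0 lebesgue_cons_sigma_additive.

Lemma lebesgue_consE (A : set R) (B : set (n.-tuple R)) :
  measurable A -> measurable B ->
  lebesgue_cons [set t | A (thead t) /\ B [tuple of behead t]] =
  (lebesgue_measure A * mu B)%E.
Proof.
move=> mA mB; rewrite -product_measure1E// /lebesgue_cons /pushforward.
congr (_ _); apply/seteqP; split => -[a t] /=.
- by rewrite theadE => -[? Bt]; split => //=; congr B : Bt; apply: val_inj.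
- by rewrite theadE => -[/= ? Bt]; split => //; congr B : Bt; apply: val_inj.
Qed.

Let lebesgue_cons_sigma_finite : sigma_finite setT lebesgue_cons.
Proof.
have /sigma_finiteP[F [TF ndF Foo]] := sigma_finiteT (@lebesgue_measure R).
have /sigma_finiteP[G [TG ndG Goo]] := sigma_finiteT mu.
exists (fun k => [set t | F k (thead t) /\ G k [tuple of behead t]]).
  apply/seteqP; split => // t _.
  have : setT (thead t) by [].
  rewrite TF => -[k _ Fk].
  have : setT [tuple of behead t] by [].
  rewrite TG => -[l _ Gl].
  exists (maxn k l) => //; split.
  - by move: Fk; apply/subsetPset/ndF/leq_maxl.
  - by move: Gl; apply/subsetPset/ndG/leq_maxr.
move=> k; have [mF Fkoo] := Foo k; have [mG Gkoo] := Goo k; split.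
  apply: measurableI.
    rewrite -[X in measurable X]setTI.
    exact: (@measurable_tnth _ _ _ ord0).
  by rewrite -[X in measurable X]setTI; exact: measurable_behead.
by rewrite lebesgue_consE// lte_mul_pinfty// ge0_fin_numE.
Qed.

HB.instance Definition _ := Measure_isSigmaFinite.Build _ _ _
  lebesgue_cons lebesgue_cons_sigma_finite.

End lebesgue_cons.

Fixpoint lebesgue_Rd (R : realType) (d : nat) :
    {sigma_finite_measure set (d.-tuple R) -> \bar R} :=
  match d with
  | 0 => \d_([tuple])
  | d'.+1 => lebesgue_cons (lebesgue_Rd R d')
  end.

Lemma lebesgue_Rd_box (R : realType) (d : nat) (A : 'I_d -> set R) :
  (forall i, measurable (A i)) ->
  lebesgue_Rd R d [set t | forall i, A i (tnth t i)] =
  (\prod_(i < d) lebesgue_measure (A i))%E.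
Proof.
elim: d A => [|d IH] A mA.
  rewrite big_ord0 /= diracE mem_set//= => -[].
  by [].
rewrite big_ord_recl -IH// -lebesgue_consE//.
  congr (lebesgue_Rd _ _ _); apply/seteqP; split => t /=.
  - move=> At; split; first exact: At.
    by move=> i; have := At (lift ord0 i); rewrite [in X in X -> _](tuple_eta t) tnthS.
  - move=> [A0 At] i; case: (unliftP ord0 i) => [j ->|->//].
    by rewrite (tuple_eta t) tnthS; exact: At.
rewrite (_ : mkset _ = \bigcap_(i in [set: 'I_d])
    [set t : d.-tuple R | A (lift ord0 i) (tnth t i)]); last first.
  by apply/seteqP; split => t /= At i => [_|]; exact: At.
apply: fin_bigcap_measurable => // i _.
rewrite -[X in measurable X]setTI.
exact: (@measurable_tnth _ _ _ i).
Qed.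

Definition argmin (V : Type) (disp : Order.disp_t) (Y : porderType disp)
    (H : set V) (f : V -> Y) : set V :=
  [set x | H x /\ forall y, H y -> (f x <= f y)%O].

Section risk.
Local Open Scope ereal_scope.
Context (R : realType).

Definition sqL2norm d (T : measurableType d) (mu : {measure set T -> \bar R})
    (g : T -> R) : \bar R :=
  'N[mu]_2%:E[EFin \o g] ^+ 2.

Definition density_class d (T : measurableType d)
    (mu : {measure set T -> \bar R}) (L : R) : set (T -> R) :=
  [set p : T -> R | [/\ measurable_fun setT p, (forall x, (0 <= p x)%R),
               \int[mu]_x (p x)%:E = 1 & 'N[mu]_+oo[EFin \o p] <= L%:E]].

Definition mixture (T : Type) (M : nat) (p_ : 'I_M -> T -> R)
    (lambda : 'rV[R]_M) (x : T) : R :=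
  (\sum_(j < M) lambda ord0 j * p_ j x)%R.

Definition criterion d (T : measurableType d) (mu : {measure set T -> \bar R})
    (M n : nat) (p_ : 'I_M -> T -> R) (s : n.-tuple T) (lambda : 'rV[R]_M) :
    \bar R :=
  sqL2norm mu (mixture p_ lambda)
  - ((2 / n%:R) * \sum_(i < n) mixture p_ lambda (tnth s i))%R%:E.

Context d0 d (Omega : measurableType d0) (T : measurableType d)
  (P : probability Omega R).

Definition has_density (mu : {measure set T -> \bar R}) (p : T -> R)
    (X : {RV P >-> T}) :=
  forall A, measurable A -> distribution P X A = \int[mu]_(x in A) (p x)%:E.

Definition mutually_independent (I : finType) (X : I -> {RV P >-> T}) :=
  forall (J : {set I}) (A : I -> set T), (forall i, measurable (A i)) ->
  P (\bigcap_(i in [set` J]) (X i @^-1` A i)) =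
  \prod_(i in J) P (X i @^-1` A i).

Definition sample n (X : 'I_n -> {RV P >-> T}) (w : Omega) : n.-tuple T :=
  [tuple X i w | i < n].

Lemma measurable_sample n (X : 'I_n -> {RV P >-> T}) :
  measurable_fun setT (sample X).
Proof.
apply/measurable_fun_tnthP => i.
rewrite (_ : _ \o _ = X i); first exact: measurable_funPT.
by apply/funext => w /=; rewrite tnth_mktuple.
Qed.

HB.instance Definition _ n (X : 'I_n -> {RV P >-> T}) :=
  isMeasurableFun.Build _ _ _ _ (sample X) (measurable_sample X).

(* [\bar R]-valued, so that an estimator with infinite expected loss has
   infinite risk. *)
Definition risk (mu : {measure set T -> \bar R}) n (X : 'I_n -> {RV P >-> T})
    (phat : n.-tuple T -> T -> R) (p : T -> R) : \bar R :=
  \int[distribution P (sample X)]_s sqL2norm mu (phat s \- p)%R.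

End risk.

(* Main.v *)
Require Import Defs.
From mathcomp Require Import all_boot all_order all_algebra.
From mathcomp Require Import all_classical all_reals all_analysis.
From mathcomp Require Import measurable_realfun ess_sup_inf.
From mathcomp Require Import ring lra.
Import Order.TTheory GRing.Theory Num.Theory.
Import numFieldNormedType.Exports.
Local Open Scope classical_set_scope.
Local Open Scope ring_scope.

Set Implicit Arguments.
Unset Strict Implicit.
Unset Printing Implicit Defensive.

(* Write p_a for the mixture of the p_j with weight vector a, and l(u) for
   the empirical mean of u minus its mean under p.  Since the empirical
   criterion is quadratic, its minimizer a over the convex set H satisfies, for
   every b in H,
     |p_a - p|^2 <= |p_b - p|^2 - |p_a - p_b|^2 + 2 l(p_a - p_b).
   Expanding p_a - p_b in an orthonormal basis (e_k) of the span of the p_j, the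
   last two terms are at most the sum of the l(e_k)^2, and independence gives
   E l(e_k)^2 <= L / n.  This even yields the constant 1 in place of 4. *)

(** * Degenerate inner products *)

Section scalar_map.
Context (R : pzRingType) (V : lmodType R) (l : V -> R).
Hypothesis l_scalar : forall a u v, l (a *: u + v) = a * l u + l v.

Lemma scalar_map0 : l 0 = 0.
Proof.
have := l_scalar 1 0 0; rewrite scaler0 addr0 mul1r => /eqP.
by rewrite addrC -subr_eq subrr => /eqP.
Qed.

Lemma scalar_mapD u v : l (u + v) = l u + l v.
Proof. by rewrite -[u]scale1r l_scalar mul1r scale1r. Qed.

Lemma scalar_mapZ a u : l (a *: u) = a * l u.
Proof. by rewrite -[a *: u]addr0 l_scalar scalar_map0 addr0. Qed.

Lemma scalar_map_sum I (r : seq I) (P : pred I) (F : I -> V) :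
  l (\sum_(i <- r | P i) F i) = \sum_(i <- r | P i) l (F i).
Proof. exact: (big_morph l scalar_mapD scalar_map0). Qed.

End scalar_map.

Section semidefinite_form.
Context (R : rcfType) (V : lmodType R) (B : V -> V -> R).
Hypothesis formC : forall u v, B u v = B v u.
Hypothesis form_scalar : forall w a u v, B (a *: u + v) w = a * B u w + B v w.
Hypothesis form_ge0 : forall u, 0 <= B u u.

Let formDl u v w : B (u + v) w = B u w + B v w.
Proof. exact: (scalar_mapD (form_scalar w)). Qed.

Let formZl a u w : B (a *: u) w = a * B u w.
Proof. exact: (scalar_mapZ (form_scalar w)). Qed.

Let formDr u v w : B w (u + v) = B w u + B w v.
Proof. by rewrite !(formC w) formDl. Qed.

Let formZr a u w : B w (a *: u) = a * B w u.
Proof. by rewrite !(formC w) formZl. Qed.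

Lemma form_suml I (r : seq I) (P : pred I) (F : I -> V) w :
  B (\sum_(i <- r | P i) F i) w = \sum_(i <- r | P i) B (F i) w.
Proof. exact: (scalar_map_sum (form_scalar w)). Qed.

Lemma form_sumr I (r : seq I) (P : pred I) (F : I -> V) w :
  B w (\sum_(i <- r | P i) F i) = \sum_(i <- r | P i) B w (F i).
Proof. by rewrite formC form_suml; apply: eq_bigr => i _; rewrite formC. Qed.

Lemma form_pythagoras (I : finType) (F : I -> V) :
  (forall i j, i != j -> B (F i) (F j) = 0) ->
  B (\sum_i F i) (\sum_i F i) = \sum_i B (F i) (F i).
Proof.
move=> F_orth; rewrite form_suml; apply: eq_bigr => i _.
rewrite form_sumr (bigD1 i)//= big1 ?addr0// => j ji.
by rewrite F_orth// eq_sym.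
Qed.

(** Along the line [u + t *: e] the form is affine in [t] with slope [2 * B u e], and an affine
    function that is nonnegative everywhere has slope zero. *)
Lemma form_null u e : B e e = 0 -> B u e = 0.
Proof.
move=> e0; apply/eqP/negPn/negP => ue0.
(* This value of [t] solves [B u u + 2 * t * B u e = -1]. *)
have := form_ge0 (u + (- (B u u + 1) / (2 * B u e)) *: e).
rewrite formDl !formDr !formZl !formZr (formC e u) e0 !mulr0 addr0.
rewrite leNgt => /negP; apply.
by rewrite (_ : _ + _ = - 1) ?ltrN10//; field.
Qed.

(** Both scalings are recorded because [e = b *: u] carries orthogonality over from [u] to [e],
    while [u = a *: e] keeps [u] in the span of [e]. *)
Lemma form_normalize u : exists2 e, B e e = 0 \/ B e e = 1 &
  exists2 a, u = a *: e & exists b, e = b *: u.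
Proof.
have [u0|u0] := eqVneq (B u u) 0.
  by exists u; [left|exists 1; [|exists 1]; rewrite scale1r].
have s0 : Num.sqrt (B u u) != 0.
  by rewrite sqrtr_eq0 -ltNge lt_neqAle eq_sym u0 form_ge0.
exists ((Num.sqrt (B u u))^-1 *: u); last first.
  exists (Num.sqrt (B u u)); first by rewrite scalerA divff// scale1r.
  by exists (Num.sqrt (B u u))^-1.
right; rewrite formZl formZr mulrA -invfM -expr2 sqr_sqrtr//.
by rewrite mulVf.
Qed.

(* Vectors of norm 0 are kept as they are instead of being dropped, so that the
   expansions are genuine equalities even though the form is degenerate. *)
Lemma gram_schmidt M (f : 'I_M -> V) : exists e : 'I_M -> V,
  [/\ forall i j, i != j -> B (e i) (e j) = 0,
      forall i, B (e i) (e i) = 0 \/ B (e i) (e i) = 1 &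
      forall j, exists c : 'I_M -> R, f j = \sum_k c k *: e k].
Proof.
elim: M f => [|M IH] f; first by exists f; split=> [[]|[]|[]].
have [e [e_orth e_norm f_e]] := IH (fun i => f (lift ord0 i)).
(* The residual of the new vector after projection on the family already built. *)
pose u := f ord0 - \sum_k B (f ord0) (e k) *: e k.
have u_orth k : B u (e k) = 0.
  rewrite /u -scaleN1r formDl formZl form_suml (bigD1 k)//= formZl.
  rewrite [X in _ * (_ + X)]big1 ?addr0; last first.
    by move=> j jk; rewrite formZl e_orth// mulr0.
  (* If [e k] is null, the coefficient [B (f ord0) (e k)] is itself zero by [form_null]; if it is a
     unit vector, the projection cancels it. *)
  have [/form_null ->|->] := e_norm k; first by rewrite !(mul0r, mulr0, addr0).
  by rewrite mulr1 mulN1r subrr.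
have [e0 e0_norm [a u_e0 [b e0_u]]] := form_normalize u.
have e0_orth k : B e0 (e k) = 0 by rewrite e0_u formZl u_orth mulr0.
exists (fun i => if unlift ord0 i is Some k then e k else e0); split.
- move=> i j; case: unliftP => [i' ->|->]; case: unliftP => [j' ->|->].
  + by rewrite (inj_eq lift_inj); exact: e_orth.
  + by rewrite formC.
  + by [].
  + by rewrite eqxx.
- by move=> i; case: unliftP.
- move=> i; case: (unliftP ord0 i) => [i' ->|->].
  + have [c ->] := f_e i'.
    exists (fun i => if unlift ord0 i is Some k then c k else 0).
    rewrite big_ord_recl unlift_none scale0r add0r.
    by apply: eq_bigr => k _; rewrite liftK.
  + exists (fun i => if unlift ord0 i is Some k then B (f ord0) (e k) else a).
    rewrite big_ord_recl unlift_none -u_e0.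
    under eq_bigr do rewrite liftK.
    by rewrite subrK.
Qed.

Variable l : V -> R.
Hypothesis l_scalar : forall a u v, l (a *: u + v) = a * l u + l v.

(* First-order optimality of [v] on the segment [v, w], made quantitative by the
   strong convexity of the quadratic criterion. *)
Lemma form_argmin_gap (v w : V) :
  (forall t, 0 < t <= 1 ->
     B v v - 2 * l v <= B (v + t *: (w - v)) (v + t *: (w - v))
                        - 2 * l (v + t *: (w - v))) ->
  B (v - w) (v - w) <= B w w - 2 * l w - (B v v - 2 * l v).
Proof.
move=> v_min; have [u uE] : exists u, u = w - v by exists (w - v).
have qE t : B (v + t *: u) (v + t *: u) - 2 * l (v + t *: u) =
    B v v - 2 * l v + t * (2 * B v u - 2 * l u) + t ^+ 2 * B u u.
  rewrite formDl !formDr !formZl !formZr (formC u v).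
  by rewrite (scalar_mapD l_scalar) (scalar_mapZ l_scalar); ring.
have wE : w = v + 1 *: u by rewrite scale1r uE addrC subrK.
have -> : B (v - w) (v - w) = B u u.
  by rewrite -opprB -uE -scaleN1r formZl formZr !mulN1r opprK.
rewrite wE qE.
(* By [qE] at [t = 1] the right-hand side is the derivative at [v] in direction [u], plus [B u u]; a
   nonnegative derivative therefore suffices. *)
suff : 0 <= 2 * B v u - 2 * l u by lra.
rewrite leNgt; apply/negP; set D := _ - _ => D_lt0.
have N_ge0 := form_ge0 u.
have ND_gt0 : 0 < B u u - D by lra.
(* The exact minimizer [- D / (2 * B u u)] breaks down when [B u u = 0] and may exceed 1. This [t]
   always lies in (0, 1] and still makes the increment negative, equal to
   [- t * D ^+ 2 / (B u u - D)]. *)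
pose t := - D / (B u u - D).
have t_gt0 : 0 < t by rewrite divr_gt0// oppr_gt0.
have t_le1 : t <= 1 by rewrite ler_pdivrMr//; lra.
have := v_min t; rewrite t_gt0 t_le1 -uE qE -/D => /(_ isT).
suff : t * D + t ^+ 2 * B u u < 0 by lra.
have -> : t * D + t ^+ 2 * B u u = t * - (D ^+ 2 / (B u u - D)).
  by rewrite /t; field; rewrite gt_eqF.
rewrite mulrN oppr_lt0 mulr_gt0// divr_gt0// exprn_even_gt0//=.
by rewrite lt_eqF.
Qed.

(** Orthogonality decouples the coordinates. A unit vector contributes
    [2 * c i * l (e i) - c i ^+ 2], at most [l (e i) ^+ 2] by completing the square; a null vector
    contributes nothing, since [l] vanishes on it. *)
Lemma form_noise_le (I : finType) (e : I -> V) (c : I -> R) :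
  (forall i j, i != j -> B (e i) (e j) = 0) ->
  (forall i, B (e i) (e i) = 0 \/ B (e i) (e i) = 1) ->
  (forall i, B (e i) (e i) = 0 -> l (e i) = 0) ->
  2 * l (\sum_i c i *: e i) - B (\sum_i c i *: e i) (\sum_i c i *: e i)
    <= \sum_i l (e i) ^+ 2.
Proof.
move=> e_orth e_norm l_null.
rewrite form_pythagoras => [|i j ij]; last first.
  by rewrite formZl formZr e_orth// !mulr0.
rewrite (scalar_map_sum l_scalar) mulr_sumr -sumrB; apply: ler_sum => i _.
rewrite formZl formZr (scalar_mapZ l_scalar).
case: (e_norm i) => ei; rewrite ei.
  by rewrite l_null// !mulr0 subr0 expr0n.
have : 0 <= (c i - l (e i)) ^+ 2 by exact: sqr_ge0.
lra.
Qed.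

End semidefinite_form.

(** * The L2 inner product and measures with a density *)

Section L2_inner_product.
Context (R : realType) d (T : measurableType d).
Context (mu : {measure set T -> \bar R}).
Local Notation L2 := (LfunType mu (lee1n 2)).

Lemma LfunE (a : R) (f g : L2) x : (a *: f + g) x = a * f x + g x.
Proof. by []. Qed.

Lemma Lfun_sumE I (r : seq I) (P : pred I) (f : I -> L2) x :
  (\sum_(i <- r | P i) f i) x = \sum_(i <- r | P i) f i x.
Proof. by elim/big_rec2 : _ => // i a b Pi <-. Qed.

(** Elements of [L2] are functions, not classes modulo null sets, so this form is only positive
    semidefinite. *)
Definition L2dot (f g : L2) : R := \int[mu]_x (f x * g x).

Lemma L2dot_integrable (f g : L2) :
  mu.-integrable setT (EFin \o (fun x => f x * g x)).
Proof. exact/Lfun1_integrable/(Lfun2_mul_Lfun1 (LfunP f) (LfunP g)). Qed.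

Lemma L2dotC f g : L2dot f g = L2dot g f.
Proof. by apply: eq_Rintegral => x _; rewrite mulrC. Qed.

Lemma L2dot_scalar h a f g : L2dot (a *: f + g) h = a * L2dot f h + L2dot g h.
Proof.
rewrite /L2dot; under eq_Rintegral do rewrite LfunE mulrDl -mulrA.
rewrite RintegralD//; last exact: L2dot_integrable.
  by rewrite RintegralZl//; exact: L2dot_integrable.
exact: integrableZl (L2dot_integrable f h).
Qed.

Lemma L2dot_ge0 f : 0 <= L2dot f f.
Proof. by apply: Rintegral_ge0 => x _; exact: sqr_ge0. Qed.

Lemma L2dot_EFin f g : (L2dot f g)%:E = (\int[mu]_x (f x * g x)%:E)%E.
Proof. by rewrite fineK//; exact/integrable_fin_num/L2dot_integrable. Qed.

Lemma sqL2normE (f : L2) : sqL2norm mu f = (L2dot f f)%:E.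
Proof.
rewrite L2dot_EFin.
transitivity (\int[mu]_x `|(EFin \o f) x| `^ 2)%E; last first.
  apply: eq_integral => x _; rewrite [`|_|%E]/=.
  by rewrite poweR_EFin powR_mulrn// real_normK ?num_real// expr2.
rewrite -poweR_Lnorm// /sqL2norm -(finite_norm_fine f) poweR_EFin.
by rewrite powR_mulrn ?fine_ge0 ?Lnorm_ge0.
Qed.

Lemma Lfun2P (f : T -> R) : measurable_fun setT f ->
  (\int[mu]_x (f x ^+ 2)%:E < +oo)%E -> f \in Lfun mu 2%:E.
Proof.
move=> mf foo; rewrite inE; apply/andP; split; rewrite inE//=.
rewrite /finite_norm unlock; apply: poweR_lty.
under eq_integral => x _.
  rewrite [`|_|%E]/= poweR_EFin powR_mulrn// real_normK ?num_real//.
  over.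
exact: foo.
Qed.

End L2_inner_product.

(** * Change of measure to a density *)

Section density.
Context (R : realType) d (T : measurableType d).
Context (nu mu : {measure set T -> \bar R}) (p : T -> R).
Hypothesis mp : measurable_fun setT p.
Hypothesis p_ge0 : forall x, 0 <= p x.
Hypothesis nuE : forall A, measurable A ->
  nu A = (\int[mu]_(x in A) (p x)%:E)%E.
Local Open Scope ereal_scope.
Import HBNNSimple.

Let nnsfun_integral_density (h : {nnsfun T >-> R}) :
  \int[nu]_x (h x)%:E = \int[mu]_x ((h x)%:E * (p x)%:E).
Proof.
rewrite integralT_nnsfun sintegralE.
under eq_integral => x _.
  rewrite fimfunE -fsumEFin// ge0_mule_fsuml; last first.
    by move=> r; rewrite EFinM; exact: nnfun_muleindic_ge0.
  over.
rewrite ge0_integral_fsum//.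
- apply: eq_fsbigr => r; rewrite inE => -[x0 _ r_h].
  under eq_integral do rewrite EFinM -muleA.
  have mh : measurable (h @^-1` [set r]) by exact: measurable_sfunP.
  rewrite ge0_integralZl//.
  + rewrite nuE// integral_mkcond; congr (_ * _); apply: eq_integral => x _.
    rewrite patchE indicE; case: ifPn => _; first by rewrite mul1e.
    by rewrite mul0e.
  + apply: emeasurable_funM; apply/measurable_EFinP => //.
  + by move=> x _; rewrite mule_ge0 ?lee_fin.
  + by rewrite lee_fin -r_h.
- move=> r; apply: emeasurable_funM; apply/measurable_EFinP => //.
  by apply: measurable_funM => //; exact: measurable_indic.
- move=> r x _; rewrite mule_ge0 ?lee_fin//.
  by have := nnfun_muleindic_ge0 h r x; rewrite -EFinM lee_fin.
Qed.

(** The identity passes from simple functions to [f] by monotone convergence under both measures;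
    multiplying by [p >= 0] keeps the approximations increasing. *)
Lemma ge0_integral_density (f : T -> \bar R) : measurable_fun setT f ->
  (forall x, 0 <= f x) -> \int[nu]_x f x = \int[mu]_x (f x * (p x)%:E).
Proof.
move=> mf f0; pose h := nnsfun_approx measurableT mf.
have h_cvg x : (EFin \o h n) x @[n --> \oo] --> f x.
  exact: cvg_nnsfun_approx.
have h_nd x m n : (m <= n)%N -> ((h m x)%:E <= (h n x)%:E).
  by move=> mn; rewrite lee_fin; exact/lefP/nd_nnsfun_approx.
transitivity (limn (fun n => \int[nu]_x (h n x)%:E)).
  rewrite -monotone_convergence//.
  - by apply: eq_integral => x _; apply/esym/cvg_lim => //; exact: h_cvg.
  - by move=> n; apply/measurable_EFinP.
  - by move=> n x _; rewrite lee_fin.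
  - by move=> x _; exact: h_nd.
under eq_fun do rewrite nnsfun_integral_density.
rewrite -monotone_convergence//.
- apply: eq_integral => x _; apply/cvg_lim => //.
  by apply: cvgeZr => //; exact: h_cvg.
- by move=> n; apply: emeasurable_funM; exact/measurable_EFinP.
- by move=> n x _; rewrite mule_ge0// lee_fin.
- by move=> x _ m n mn; rewrite lee_wpmul2r ?lee_fin//; exact: h_nd.
Qed.

(** Multiplication by [p >= 0] commutes with taking positive and negative parts, which reduces this
    to the nonnegative case. *)
Lemma integral_density (f : T -> \bar R) : measurable_fun setT f ->
  \int[nu]_x f x = \int[mu]_x (f x * (p x)%:E).
Proof.
move=> mf; rewrite integralE [RHS]integralE.
rewrite !ge0_integral_density//; last 2 first.
- exact: measurable_funeneg.
- exact: measurable_funepos.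
congr (_ - _); apply: eq_integral => x _.
  by rewrite !funeposE maxe_pMl ?mul0e ?lee_fin.
by rewrite !funenegE -mulNe maxe_pMl ?mul0e ?lee_fin.
Qed.

End density.

(** * Independent samples from a bounded density *)

Section independence.
Context (R : realType) d0 d (Omega : measurableType d0) (T : measurableType d).
Context (P : probability Omega R).
Local Open Scope ereal_scope.

Lemma mutually_independent_pair (I : finType) (X : I -> {RV P >-> T}) i j :
  mutually_independent X -> i != j ->
  forall A B, measurable A -> measurable B ->
  P (X i @^-1` A `&` X j @^-1` B) = P (X i @^-1` A) * P (X j @^-1` B).
Proof.
move=> X_indep ij A B mA mB.
have ji : (j == i) = false by rewrite eq_sym (negbTE ij).
have := X_indep [set i; j]%SET (fun k => if k == i then A else B).
have mAB k : measurable (if k == i then A else B) by case: ifP.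
move=> /(_ mAB); rewrite big_setU1/= ?inE// big_set1 eqxx ji => <-.
congr (P _); apply/seteqP; split => w /=.
  by move=> [Aw Bw] k /=; rewrite !inE => /orP[]/eqP->; rewrite ?eqxx ?ji.
move=> ABw; split.
  by have := ABw i; rewrite /= !inE eqxx; exact.
by have := ABw j; rewrite /= !inE eqxx orbT ji; exact.
Qed.

(** Independence makes the law of the pair agree with the product of the laws on rectangles, hence
    everywhere; Fubini then factors the integral. *)
Lemma independent_integralM (X Y : {RV P >-> T}) (f g : T -> R) :
  (forall A B, measurable A -> measurable B ->
    P (X @^-1` A `&` Y @^-1` B) = P (X @^-1` A) * P (Y @^-1` B)) ->
  measurable_fun setT f -> measurable_fun setT g ->
  P.-integrable setT (EFin \o (f \o X)) ->
  P.-integrable setT (EFin \o (g \o Y)) ->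
  P.-integrable setT (EFin \o (fun w => f (X w) * g (Y w))%R) ->
  \int[P]_w (f (X w) * g (Y w))%:E =
  (\int[P]_w (f (X w))%:E) * (\int[P]_w (g (Y w))%:E).
Proof.
move=> XY_indep mf mg fX_int gY_int fg_int.
pose Z w := (X w, Y w).
have mZ : measurable_fun setT Z by apply: measurable_fun_pair.
pose F (z : T * T) := (f z.1 * g z.2)%:E.
have mF : measurable_fun setT F.
  apply/measurable_EFinP; apply: measurable_funM.
    exact: measurableT_comp mf measurable_fst.
  exact: measurableT_comp mg measurable_snd.
have lawE A : measurable A ->
    (distribution P X \x distribution P Y) A = pushforward P Z A.
  by move=> mA; apply: product_measure_unique => // *; rewrite -XY_indep.
have F_int : (pushforward P Z).-integrable setT F.
  exact: integrable_pushforward.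
(* Fubini asks for integrability under the product law; it is carried over from the joint law. *)
have F_int' : (distribution P X \x distribution P Y).-integrable setT F.
  apply/integrableP; split => //.
  move/integrableP : F_int => [_]; apply: le_lt_trans.
  by rewrite (eq_measure_integral (pushforward P Z))// => A mA _; exact: lawE.
transitivity (\int[pushforward P Z]_z F z); first by rewrite integral_pushforward.
rewrite (eq_measure_integral (distribution P X \x distribution P Y)); last first.
  by move=> A mA _; apply/esym; exact: lawE.
rewrite -integral12_prod_meas1//.
have gE : \int[distribution P Y]_y (g y)%:E = \int[P]_w (g (Y w))%:E.
  by rewrite integral_distribution//; exact/measurable_EFinP.
have g_int : (distribution P Y).-integrable setT (EFin \o g).
  by apply: integrable_pushforward => //; exact/measurable_EFinP.
have f_int : (distribution P X).-integrable setT (EFin \o f).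
  by apply: integrable_pushforward => //; exact/measurable_EFinP.
transitivity (\int[distribution P X]_x ((f x)%:E * \int[P]_w (g (Y w))%:E)).
  by apply: eq_integral => x _; rewrite /fubini_F -gE -integralZl.
rewrite -gE -(fineK (integrable_fin_num measurableT g_int)) integralZr//.
by rewrite integral_distribution//; exact/measurable_EFinP.
Qed.

End independence.

(** * Consequences of the bound [L] on the density *)

Section bounded_density.
Context (R : realType) d (T : measurableType d).
Context (mu : {measure set T -> \bar R}) (L : R) (p : T -> R).
Hypothesis p_class : density_class mu L p.
Local Open Scope ereal_scope.

Lemma density_class_ae_le : {ae mu, forall x, (p x <= L)%R}.
Proof.
have [mp p_ge0 p1 pL] := p_class.
(* The sup norm takes the default value 0 when the whole space is null and would then bound nothing;
   the unit mass of [p] excludes this. *)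
have mu_gt0 : 0 < mu setT.
  rewrite lt0e measure_ge0 andbT; apply/eqP => mu0.
  have : \int[mu]_x (p x)%:E = 0.
    rewrite -(@integral_abs_eq0 _ _ _ mu _ (EFin \o p) measurableT _ mu0).
      by apply: eq_integral => x _; rewrite gee0_abs ?lee_fin.
    exact/measurable_EFinP.
  by rewrite p1 => /eqP; rewrite onee_eq0.
move: pL; rewrite unlock mu_gt0 => /ess_supP; apply: filterS => x /=.
by rewrite lee_fin ger0_norm.
Qed.

Lemma density_class_integral_le (f : T -> \bar R) :
  measurable_fun setT f -> (forall x, 0 <= f x) ->
  \int[mu]_x (f x * (p x)%:E) <= L%:E * \int[mu]_x f x.
Proof.
have [mp p_ge0 p1 pL] := p_class.
have L_ge0 : (0 <= L)%R by rewrite -lee_fin (le_trans _ pL)// Lnorm_ge0.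
move=> mf f0; rewrite -ge0_integralZl_EFin//.
apply: ae_ge0_le_integral => //.
- by move=> x _; rewrite mule_ge0// lee_fin.
- by apply: emeasurable_funM => //; exact/measurable_EFinP.
- by move=> x _; rewrite mule_ge0// lee_fin.
- exact: emeasurable_funM.
- apply: filterS density_class_ae_le => x pL_x _.
  by rewrite muleC lee_wpmul2r// lee_fin.
Qed.

(** Bounding one factor of [p * p] by [L] leaves [L] times the unit mass of [p]. *)
Lemma density_class_Lfun2 : p \in Lfun mu 2%:E.
Proof.
have [mp p_ge0 p1 pL] := p_class.
apply: Lfun2P => //.
rewrite (eq_integral (fun x => (p x)%:E * (p x)%:E)); last first.
  by move=> x _; rewrite expr2 EFinM.
apply: le_lt_trans (density_class_integral_le _ _) _ => //.
- exact/measurable_EFinP.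
- by rewrite p1 mule1 ltry.
Qed.

End bounded_density.

(** * Variance of empirical means *)

Section sampling.
Context (R : realType) d0 d (Omega : measurableType d0) (T : measurableType d).
Context (P : probability Omega R) (mu : {measure set T -> \bar R}).
Context (L : R) (p : T -> R) (p_class : density_class mu L p).
Local Notation L2 := (LfunType mu (lee1n 2)).
Local Notation L2P := (LfunType P (lee1n 2)).

Let pL2 : L2 := Lfun_Sub (lee1n 2) (density_class_Lfun2 p_class).

Section one_draw.
Context (X : {RV P >-> T}) (X_density : has_density mu p X).

Lemma ge0_integral_has_density (f : T -> \bar R) : measurable_fun setT f ->
  (forall x, 0 <= f x)%E ->
  (\int[P]_w f (X w) = \int[mu]_x (f x * (p x)%:E))%E.
Proof.
have [mp p_ge0 p1 pL] := p_class.
move=> mf f0; rewrite -(ge0_integral_density mp p_ge0 X_density)//.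
by rewrite ge0_integral_distribution.
Qed.

Lemma integral_sqr_has_density_le (e : L2) :
  (\int[P]_w (e (X w) ^+ 2)%:E <= (L * L2dot e e)%:E)%E.
Proof.
have me2 : measurable_fun setT (fun x => (e x ^+ 2)%:E).
  by apply/measurable_EFinP; exact: measurable_funX.
rewrite (ge0_integral_has_density me2); last by move=> x; rewrite lee_fin sqr_ge0.
rewrite EFinM L2dot_EFin; apply: density_class_integral_le => //.
by move=> x; rewrite lee_fin sqr_ge0.
Qed.

Lemma Lfun2_has_density (e : L2) : e \o X \in Lfun P 2%:E.
Proof.
apply: Lfun2P; first exact: measurableT_comp.
exact: le_lt_trans (integral_sqr_has_density_le e) (ltry _).
Qed.

(** Means under [p] become inner products with [p], so the empirical noise is a linear functional on
    [L2]. *)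
Lemma integral_has_density (e : L2) :
  (\int[P]_w (e (X w))%:E = (L2dot e pL2)%:E)%E.
Proof.
have [mp p_ge0 p1 pL] := p_class.
have eX_int : P.-integrable setT (EFin \o (e \o X)).
  apply/Lfun1_integrable; apply: Lfun_subset12; last exact: Lfun2_has_density.
  exact: fin_num_measure.
rewrite L2dot_EFin.
transitivity (\int[distribution P X]_x (e x)%:E)%E.
  by rewrite integral_distribution//; exact/measurable_EFinP.
rewrite (integral_density mp p_ge0 X_density)//; last exact/measurable_EFinP.
Qed.

End one_draw.

Context (n : nat) (X : 'I_n -> {RV P >-> T}).
Hypothesis n_gt0 : (0 < n)%N.
Hypothesis X_indep : mutually_independent X.
Hypothesis X_density : forall i, has_density mu p (X i).

Definition sample_mean (s : n.-tuple T) (e : L2) : R :=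
  n%:R^-1 * \sum_(i < n) e (tnth s i).

(** The centered draws are pairwise orthogonal in [L2P] by independence, so Pythagoras turns the
    second moment of their mean into the sum of [n] variances divided by the square of [n]. Each
    variance is at most a second moment, hence at most [L * L2dot e e]. *)
Lemma integral_sqr_noise_le (e : L2) :
  (\int[P]_w ((sample_mean (sample X w) e - L2dot e pL2) ^+ 2)%:E
    <= (L / n%:R * L2dot e e)%:E)%E.
Proof.
pose m := L2dot e pL2.
have [mp p_ge0 p1 pL] := p_class.
pose one : L2P := Lfun_Sub (lee1n 2) (Lfun_cst P 1 2).
pose U i : L2P := Lfun_Sub (lee1n 2) (Lfun2_has_density (X_density i) e).
(* Centering is written as a combination inside [L2P], so that covariances are inner products and
   bilinearity computes them. *)
pose Y i := (- m) *: one + U i.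
have YE i w : Y i w = e (X i w) - m by rewrite LfunE mulr1 addrC.
have YD i : Y i = (- m) *: one + U i by [].
clearbody Y.
have me : measurable_fun setT e by [].
have one_one : L2dot one one = 1.
  apply: EFin_inj; rewrite L2dot_EFin.
  rewrite (eq_integral (cst 1%E)) => [|w _]; last by rewrite mulr1.
  rewrite integral_cst// mul1e; exact: probability_setT.
have U_one i : L2dot (U i) one = m.
  apply: EFin_inj; rewrite L2dot_EFin -(integral_has_density (X_density i)).
  by apply: eq_integral => w _; rewrite mulr1.
have Y_one i : L2dot (Y i) one = 0.
  by rewrite YD L2dot_scalar one_one U_one mulr1 addNr.
have Y_orth i j : i != j -> L2dot (Y i) (Y j) = 0.
  move=> ij; apply: EFin_inj; rewrite L2dot_EFin.
  under eq_integral do rewrite !YE.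
  have intY k : P.-integrable setT (EFin \o ((fun x => e x - m) \o X k)).
    have /= := L2dot_integrable (Y k) one.
    by apply: eq_integrable => // w _ /=; rewrite mulr1 YE.
  rewrite (@independent_integralM _ _ _ _ _ _ (X i) (X j)
    (fun x => e x - m) (fun x => e x - m))//.
  - rewrite (_ : \int[P]_w _ = (L2dot (Y i) one)%:E)%E; last first.
      rewrite L2dot_EFin; apply: eq_integral => w _.
      by rewrite mulr1 YE.
    by rewrite Y_one mul0e.
  - exact: mutually_independent_pair.
  - exact: measurable_funB.
  - exact: measurable_funB.
  - have := L2dot_integrable (Y i) (Y j).
    by apply: eq_integrable => // w _ /=; rewrite !YE.
have Y_le i : L2dot (Y i) (Y i) <= L * L2dot e e.
  (* Variance as second moment minus squared mean, from the orthogonality of [Y i] to constants. *)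
  have -> : L2dot (Y i) (Y i) = L2dot (U i) (U i) - m ^+ 2.
    rewrite {1}YD L2dot_scalar (L2dotC one) Y_one mulr0 add0r L2dotC.
    by rewrite YD L2dot_scalar L2dotC U_one; ring.
  have : L2dot (U i) (U i) <= L * L2dot e e.
    rewrite -lee_fin L2dot_EFin.
    apply: le_trans (integral_sqr_has_density_le (X_density i) e).
    by under eq_integral do rewrite -expr2.
  by have := sqr_ge0 m; lra.
pose W := n%:R^-1 *: \sum_i Y i.
have n_neq0 : n%:R != 0 :> R by rewrite pnatr_eq0 -lt0n.
have WE w : sample_mean (sample X w) e - m = W w.
  rewrite -[W]addr0 LfunE addr0 Lfun_sumE (eq_bigr (fun i => e (X i w) - m))//.
  rewrite sumrB sumr_const card_ord mulrBr -[m *+ n]mulr_natl mulKf//.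
  by congr (_ * _ - _); apply: eq_bigr => i _; rewrite tnth_mktuple.
have -> : (\int[P]_w ((sample_mean (sample X w) e - m) ^+ 2)%:E)%E =
    (L2dot W W)%:E.
  by rewrite L2dot_EFin; apply: eq_integral => w _; rewrite WE expr2.
rewrite lee_fin /W (scalar_mapZ (L2dot_scalar _)) L2dotC.
rewrite (scalar_mapZ (L2dot_scalar _)) (@form_pythagoras R L2P _ (@L2dotC _ _ _ P)
  (@L2dot_scalar _ _ _ P))//.
rewrite mulrA; apply: le_trans (ler_wpM2l _ (ler_sum _ (fun i _ => Y_le i))) _.
  by rewrite mulr_ge0// invr_ge0.
rewrite sumr_const card_ord -mulr_natl.
by rewrite le_eqVlt; apply/orP; left; apply/eqP; field.
Qed.

End sampling.

(** * Empirical risk minimization over a convex set *)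

Section convex_aggregation.
Context (R : realType) d (T : measurableType d).
Context (mu : {measure set T -> \bar R}).
Local Notation L2 := (LfunType mu (lee1n 2)).
Context (M : nat) (p_ : 'I_M -> T -> R) (p_L2 : forall j, p_ j \in Lfun mu 2%:E).

Definition L2mixture (lambda : 'rV[R]_M) : L2 :=
  \sum_j lambda ord0 j *: Lfun_Sub (lee1n 2) (p_L2 j).

Lemma L2mixtureE lambda : L2mixture lambda = mixture p_ lambda :> (T -> R).
Proof. by apply/funext => x; rewrite Lfun_sumE. Qed.

Lemma L2mixture_segment t a b :
  L2mixture (a + t *: (b - a)) =
  L2mixture a + t *: (L2mixture b - L2mixture a).
Proof.
rewrite /L2mixture -sumrB scaler_sumr -big_split/=; apply: eq_bigr => j _.
by rewrite !mxE -scalerBl scalerA -scalerDl.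
Qed.

(** * The loss as a quadratic function of the weights *)

Section loss.
Variable p : L2.

(** The squared distance from [u] to [p], kept expanded: the first two terms are the population
    counterpart of the empirical criterion and the last is constant in [u]. *)
Definition L2loss (u : L2) : R := L2dot u u - 2 * L2dot u p + L2dot p p.

Lemma L2lossE u : L2loss u = L2dot (u - p) (u - p).
Proof.
have dotB w : L2dot (u - p) w = L2dot u w - L2dot p w.
  by rewrite addrC -scaleN1r L2dot_scalar mulN1r addrC.
by rewrite dotB !(L2dotC _ (u - p)) !dotB (L2dotC p u) /L2loss; ring.
Qed.

Lemma sqL2norm_loss lambda :
  sqL2norm mu (mixture p_ lambda \- p) = (L2loss (L2mixture lambda))%:E.
Proof.
rewrite L2lossE -sqL2normE; congr sqL2norm; apply/funext => x /=.
by rewrite -L2mixtureE.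
Qed.

(** This explicit polynomial in the weights yields both continuity of the loss and its measurability
    along a measurable choice of weights. *)
Lemma L2loss_mixture lambda : L2loss (L2mixture lambda) =
  \sum_j lambda ord0 j * (\sum_k lambda ord0 k *
      L2dot (Lfun_Sub (lee1n 2) (p_L2 k)) (Lfun_Sub (lee1n 2) (p_L2 j)))
  - 2 * \sum_j lambda ord0 j * L2dot (Lfun_Sub (lee1n 2) (p_L2 j)) p
  + L2dot p p.
Proof.
have sumE (w : L2) : L2dot (L2mixture lambda) w =
    \sum_j lambda ord0 j * L2dot (Lfun_Sub (lee1n 2) (p_L2 j)) w.
  rewrite (scalar_map_sum (L2dot_scalar w)); apply: eq_bigr => j _.
  exact: (scalar_mapZ (L2dot_scalar w)).
rewrite /L2loss sumE; congr (_ - _ + _); last by rewrite sumE.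
apply: eq_bigr => j _; rewrite L2dotC sumE.
by [].
Qed.

Lemma continuous_L2loss : continuous (fun lambda => L2loss (L2mixture lambda)).
Proof.
have addc (f g : 'rV[R]_M -> R) : continuous f -> continuous g ->
    continuous (fun x => f x + g x).
  by move=> cf cg x; exact: cvgD (cf x) (cg x).
have oppc (f : 'rV[R]_M -> R) : continuous f -> continuous (fun x => - f x).
  by move=> cf x; exact: cvgN (cf x).
have mulc (f g : 'rV[R]_M -> R) : continuous f -> continuous g ->
    continuous (fun x => f x * g x).
  by move=> cf cg x; exact: cvgM (cf x) (cg x).
have sumc (f : 'I_M -> 'rV[R]_M -> R) : (forall j, continuous (f j)) ->
    continuous (fun x => \sum_j f j x).
  by move=> cf; apply: continuous_big => [|j _]; [exact: add_continuous|exact: cf].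
have coordc j : continuous (fun x : 'rV[R]_M => x ord0 j).
  exact: coord_continuous.
have cstc (c : R) : continuous (fun _ : 'rV[R]_M => c) by exact: cst_continuous.
rewrite (funext L2loss_mixture); apply: (addc) => //; apply: (addc).
  apply: (sumc) => j; apply: (mulc) => //; apply: (sumc) => k.
  by apply: (mulc) => //; exact: cstc.
apply: (oppc); apply: (mulc) => //.
by apply: (sumc) => j; apply: (mulc) => //; exact: cstc.
Qed.

Lemma measurable_L2loss d' (S : measurableType d') (lambda : S -> 'rV[R]_M) :
  (forall j, measurable_fun setT (fun s => lambda s ord0 j)) ->
  measurable_fun setT (fun s => L2loss (L2mixture (lambda s))).
Proof.
move=> mlambda.
under eq_fun do rewrite L2loss_mixture.
apply: measurable_funD => //; apply: measurable_funB.
  apply: measurable_sum => j; apply: measurable_funM => //.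
  by apply: measurable_sum => k; exact: measurable_funM.
apply: measurable_funM => //; apply: measurable_sum => j.
exact: measurable_funM.
Qed.

End loss.

Lemma criterion_L2mixture n (s : n.-tuple T) lambda :
  criterion mu p_ s lambda =
  (L2dot (L2mixture lambda) (L2mixture lambda)
   - 2 * sample_mean s (L2mixture lambda))%:E.
Proof.
rewrite /criterion -L2mixtureE sqL2normE -EFinB /sample_mean mulrA.
by [].
Qed.

Lemma sample_mean_scalar n (s : n.-tuple T) a (u v : L2) :
  sample_mean s (a *: u + v) = a * sample_mean s u + sample_mean s v.
Proof.
rewrite /sample_mean mulrCA -mulrDr; congr (_ * _).
by rewrite mulr_sumr -big_split.
Qed.

Lemma measurable_sample_mean n (e : L2) :
  measurable_fun setT (fun s : n.-tuple T => sample_mean s e).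
Proof.
apply: measurable_funM => //; apply: measurable_sum => i.
by apply: measurableT_comp => //; exact: measurable_tnth.
Qed.

(** Convexity keeps the segment from [a] to [b] inside [H]; this supplies the hypothesis of
    [form_argmin_gap]. *)
Lemma criterion_argmin_segment n (s : n.-tuple T) (H : set 'rV[R]_M) a b :
  convex_set H -> argmin H (criterion mu p_ s) a -> H b ->
  forall t, 0 < t <= 1 ->
  L2dot (L2mixture a) (L2mixture a) - 2 * sample_mean s (L2mixture a) <=
  L2dot (L2mixture a + t *: (L2mixture b - L2mixture a))
        (L2mixture a + t *: (L2mixture b - L2mixture a))
  - 2 * sample_mean s (L2mixture a + t *: (L2mixture b - L2mixture a)).
Proof.
move=> H_convex [Ha a_min] Hb t /andP[t_gt0 t_le1].
rewrite -L2mixture_segment -lee_fin -!criterion_L2mixture; apply: a_min.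
have -> : a + t *: (b - a) = t *: b + (1 - t) *: a.
  by rewrite scalerBl scale1r scalerBr addrCA.
exact/set_mem/(H_convex b a (Itv01 (ltW t_gt0) t_le1)
                 (mem_set Hb) (mem_set Ha)).
Qed.

(* Strong convexity leaves the noise at [u - w] minus the squared norm of
   [u - w]; in an orthonormal basis each coordinate is at most the squared
   noise of the basis vector. *)
Lemma erm_oracle_inequality n (s : n.-tuple T) (H : set 'rV[R]_M) (p : L2)
    (e : 'I_M -> L2) a b :
  convex_set H -> argmin H (criterion mu p_ s) a -> H b ->
  (forall i j, i != j -> L2dot (e i) (e j) = 0) ->
  (forall i, L2dot (e i) (e i) = 0 \/ L2dot (e i) (e i) = 1) ->
  (forall j, exists c : 'I_M -> R,
     Lfun_Sub (lee1n 2) (p_L2 j) = \sum_k c k *: e k) ->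
  (forall k, L2dot (e k) (e k) = 0 ->
     sample_mean s (e k) - L2dot (e k) p = 0) ->
  L2loss p (L2mixture a) <=
  L2loss p (L2mixture b) + \sum_k (sample_mean s (e k) - L2dot (e k) p) ^+ 2.
Proof.
move=> H_convex a_min Hb e_orth e_norm e_gen e_null.
have gap := form_argmin_gap (@L2dotC _ _ _ mu) (@L2dot_scalar _ _ _ mu)
  (@L2dot_ge0 _ _ _ mu) (sample_mean_scalar s)
  (criterion_argmin_segment H_convex a_min Hb).
pose noise (v : L2) := sample_mean s v - L2dot v p.
have noise_scalar t u v : noise (t *: u + v) = t * noise u + noise v.
  by rewrite /noise sample_mean_scalar L2dot_scalar; ring.
have [c cE] : exists c : 'I_M -> R,
    L2mixture a - L2mixture b = \sum_k c k *: e k.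
  have [g gE] := choice e_gen.
  (* Differences of weights composed with the coordinates [g j k] of the [p_ j] in the family
     [e]. *)
  exists (fun k => \sum_j (a ord0 j - b ord0 j) * g j k).
  rewrite /L2mixture -sumrB.
  under eq_bigr do rewrite -scalerBl gE scaler_sumr.
  rewrite exchange_big/=; apply: eq_bigr => k _; rewrite scaler_suml.
  by apply: eq_bigr => j _; rewrite scalerA.
have := form_noise_le (@L2dotC _ _ _ mu) (@L2dot_scalar _ _ _ mu)
  noise_scalar c e_orth e_norm e_null.
rewrite -cE -/(noise _) => noise_le.
have noiseB u v : noise (u - v) = noise u - noise v.
  by rewrite addrC -scaleN1r noise_scalar mulN1r addrC.
rewrite noiseB in noise_le.
(* Each loss equals its criterion value plus twice its noise plus [L2dot p p]; when the two bounds
   are added, the squared norm of the difference cancels. *)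
move: gap noise_le; rewrite /L2loss /noise; lra.
Qed.

(** * Integrating the oracle inequality over the sample *)

Section risk_bound.
Context d0 (Omega : measurableType d0) (P : probability Omega R) (n : nat).
Context (L : R) (p : T -> R) (p_class : density_class mu L p).
Context (X : 'I_n -> {RV P >-> T}).
Hypothesis n_gt0 : (0 < n)%N.
Hypothesis X_indep : mutually_independent X.
Hypothesis X_density : forall i, has_density mu p (X i).
Context (H : set 'rV[R]_M) (lambdaC : n.-tuple T -> 'rV[R]_M).
Hypothesis H_convex : convex_set H.
Hypothesis lambdaC_measurable :
  forall j, measurable_fun setT (fun s => lambdaC s ord0 j).
Hypothesis lambdaC_argmin :
  forall s, argmin H (criterion mu p_ s) (lambdaC s).

Let pL2 : L2 := Lfun_Sub (lee1n 2) (density_class_Lfun2 p_class).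

Lemma erm_risk_le lambda : H lambda ->
  (risk mu X (fun s => mixture p_ (lambdaC s)) p <=
   (L2loss pL2 (L2mixture lambda) + M%:R * (L / n%:R))%:E)%E.
Proof.
move=> Hlambda.
have L_ge0 : 0 <= L.
  by have [_ _ _] := p_class; rewrite -lee_fin; apply: le_trans; exact: Lnorm_ge0.
have [e [e_orth e_norm e_gen]] := gram_schmidt (@L2dotC _ _ _ mu)
  (@L2dot_scalar _ _ _ mu) (@L2dot_ge0 _ _ _ mu)
  (fun j => Lfun_Sub (lee1n 2) (p_L2 j)).
pose Z k w := sample_mean (sample X w) (e k) - L2dot (e k) pL2.
have mZ k : measurable_fun setT (Z k).
  apply: measurable_funB => //.
  apply: (measurableT_comp (measurable_sample_mean (e k))).
  exact: measurable_sample.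
have Z_le k : (\int[P]_w (Z k w ^+ 2)%:E <= (L / n%:R * L2dot (e k) (e k))%:E)%E.
  exact: integral_sqr_noise_le.
(* A null [e k] can still be nonzero at a sample point, so its noise vanishes only almost surely:
   its second moment is zero by [Z_le]. *)
have Z_ae : {ae P, forall w k, L2dot (e k) (e k) = 0 -> Z k w = 0}.
  apply: filter_forall => k.
  have [ek|/eqP ek] := eqVneq (L2dot (e k) (e k)) 0; last first.
    by apply: nearW => w /ek.
  have mZ2 : measurable_fun setT (fun w => (Z k w ^+ 2)%:E).
    by apply/measurable_EFinP; exact: measurable_funX.
  have /(ae_eq_integral_abs P measurableT mZ2) :
      (\int[P]_w `|(Z k w ^+ 2)%:E| = 0)%E.
    apply/eqP; rewrite eq_le integral_ge0// andbT.
    under eq_integral do rewrite gee0_abs ?lee_fin ?sqr_ge0//.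
    by apply: le_trans (Z_le k) _; rewrite ek mulr0.
  apply: filterS => w /(_ I)[] /eqP; rewrite sqrf_eq0 => /eqP Zk0 _.
  exact: Zk0.
have mloss : measurable_fun setT (fun s => (L2loss pL2 (L2mixture (lambdaC s)))%:E).
  by apply/measurable_EFinP; exact: measurable_L2loss.
have -> : risk mu X (fun s => mixture p_ (lambdaC s)) p =
    (\int[P]_w (L2loss pL2 (L2mixture (lambdaC (sample X w))))%:E)%E.
  rewrite /risk (eq_integral (fun s => (L2loss pL2 (L2mixture (lambdaC s)))%:E)).
    rewrite ge0_integral_distribution// => s.
    by rewrite lee_fin L2lossE L2dot_ge0.
  by move=> s _; exact: (sqL2norm_loss pL2).
apply: (@le_trans _ _ (\int[P]_w ((L2loss pL2 (L2mixture lambda))%:E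
    + \sum_k (Z k w ^+ 2)%:E))%E).
  apply: ae_ge0_le_integral => //.
  - by move=> w _; rewrite lee_fin L2lossE L2dot_ge0.
  - exact: measurableT_comp mloss (measurable_sample X).
  - move=> w _; rewrite adde_ge0 ?lee_fin ?L2lossE ?L2dot_ge0// sume_ge0// => k _.
    by rewrite lee_fin sqr_ge0.
  - apply: emeasurable_funD => //; apply: emeasurable_sum => k.
    by apply/measurable_EFinP; exact: measurable_funX.
  - apply: filterS Z_ae => w Zw _; rewrite sumEFin -EFinD lee_fin.
    exact: (erm_oracle_inequality H_convex (lambdaC_argmin _) Hlambda e_orth
      e_norm e_gen Zw).
rewrite ge0_integralD//; last 3 first.
- by move=> w _; rewrite lee_fin L2lossE L2dot_ge0.
- by move=> w _; rewrite sume_ge0// => k _; rewrite lee_fin sqr_ge0.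
- apply: emeasurable_sum => k.
  by apply/measurable_EFinP; exact: measurable_funX.
rewrite integral_cst// [X in (_ * X)%E]probability_setT mule1.
rewrite [leRHS]EFinD leeD2l//.
rewrite ge0_integral_sum//; last 2 first.
- by move=> k; apply/measurable_EFinP; exact: measurable_funX.
- by move=> k w _; rewrite lee_fin sqr_ge0.
(* Each of the [M] basis vectors has squared norm 0 or 1 and so costs at most [L / n]. *)
apply: (@le_trans _ _ (\sum_(k < M) (L / n%:R)%:E)%E); last first.
  by rewrite sumEFin sumr_const card_ord mulr_natl.
apply: lee_sum => k _; apply: le_trans (Z_le k) _.
rewrite lee_fin ler_piMr ?divr_ge0//.
by case: (e_norm k) => ->; rewrite ?ler01.
Qed.

End risk_bound.
End convex_aggregation.

Theorem theorem2p2 (R : realType) (d M n : nat) (L : R)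
  (d_ge1 : (1 <= d)%N) (L_gt0 : 0 < L) (M_ge2 : (2 <= M)%N) (n_ge1 : (1 <= n)%N)
  (H : set 'rV[R]_M)
  (H_nonempty : H !=set0) (H_convex : convex_set H) (H_compact : compact H)
  (p_ : 'I_M -> d.-tuple R -> R)
  (p_L2 : forall j, p_ j \in Lfun (lebesgue_Rd R d) 2%:E)
  (p : d.-tuple R -> R) (p_P0 : density_class (lebesgue_Rd R d) L p)
  (disp : measure_display) (Omega : measurableType disp)
  (P : probability Omega R)
  (X : 'I_n -> {RV P >-> d.-tuple R})
  (X_indep : mutually_independent X)
  (X_density : forall i, has_density (lebesgue_Rd R d) p (X i))
  (lambdaC : n.-tuple (d.-tuple R) -> 'rV[R]_M)
  (lambdaC_measurable : forall j, measurable_fun setT (fun s => lambdaC s ord0 j))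
  (lambdaC_argmin :
     forall s, argmin H (criterion (lebesgue_Rd R d) p_ s) (lambdaC s)) :
  let loss (lambda : 'rV[R]_M) :=
    sqL2norm (lebesgue_Rd R d) (mixture p_ lambda \- p) in
  exists2 lambda_min, argmin H loss lambda_min &
    (risk (lebesgue_Rd R d) X (fun s => mixture p_ (lambdaC s)) p
       <= loss lambda_min + (4 * L * M%:R / n%:R)%:E)%E.
Proof.
move=> loss.
pose pL2 := Lfun_Sub (lee1n 2) (density_class_Lfun2 p_P0).
have lossE lambda : loss lambda = (L2loss pL2 (L2mixture p_L2 lambda))%:E.
  exact: (sqL2norm_loss p_L2 pL2).
have loss_continuous : continuous (fun l => L2loss pL2 (L2mixture p_L2 l)).
  exact: continuous_L2loss.
(* The minimum over [H] is attained, the loss being continuous on a nonempty compact set. *)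
have [a /set_mem Ha a_min] := EVT_min_rV H_nonempty H_compact
  (continuous_subspaceT loss_continuous).
exists a.
  by split => // b Hb; rewrite !lossE lee_fin; apply: a_min; exact: mem_set.
apply: le_trans (erm_risk_le p_L2 p_P0 n_ge1 X_indep X_density H_convex
  lambdaC_measurable lambdaC_argmin Ha) _.
rewrite lossE -EFinD lee_fin lerD2l.
(* The bound obtained has [M * L / n], a nonnegative quantity, which is at most four times
   itself. *)
rewrite (_ : 4 * L * M%:R / n%:R = 4 * (M%:R * (L / n%:R))); last by ring.
by rewrite ler_peMl ?ler1n// mulr_ge0// divr_ge0// ltW.
Qed.
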